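(* Let $X$ be a set and let $R:X\times X\to X\times X$ be a set-theoretic Yang-Baxter operator. Then $(C_n^D(X),\partial_n^{YB})$ is a sub-chain complex of $(C_n^{YB}(X),\partial_n^{YB})$; that is, $\partial_n^{YB}(C_n^D(X))\subset C_{n-1}^D(X)$ for every $n>0$.
   Context: A set-theoretic Yang-Baxter operator on $X$ is an invertible (bijective) function $R=(R_1,R_2):X\times X\to X\times X$ satisfying $(R\times \mathrm{Id}_X)\circ(\mathrm{Id}_X\times R)\circ(R\times \mathrm{Id}_X)=(\mathrm{Id}_X\times R)\circ(R\times \mathrm{Id}_X)\circ(\mathrm{Id}_X\times R)$ on $X^3$; here $R_1,R_2:X\times X\to X$ are its two components. For $n>0$, $C_n^{YB}(X)$ is the free abelian group generated by $X^n$ (and $C_0^{YB}(X)$ is the free abelian group on the one-point set $X^0$). The boundary homomorphism $\partial_n^{YB}:C_n^{YB}(X)\to C_{n-1}^{YB}(X)$ is $\partial_n^{YB}=\sum_{i=1}^n(-1)^{i+1}(d_{i,n}^l-d_{i,n}^r)$, where the face maps $d^l_{i,n},d^r_{i,n}$ are the linear extensions of the maps $X^n\to X^{n-1}$ $$d_{i,n}^{l} = (R_{2} \times \mathrm{Id}_{X}^{\times (n-2)}) \circ (\mathrm{Id}_{X} \times R \times \mathrm{Id}_{X}^{\times (n-3)}) \circ \cdots \circ (\mathrm{Id}_{X}^{\times (i-2)} \times R \times \mathrm{Id}_{X}^{\times (n-i)}),$$ $$d_{i,n}^{r} = (\mathrm{Id}_{X}^{\times (n-2)} \times R_{1}) \circ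 (\mathrm{Id}_{X}^{\times (n-3)} \times R \times \mathrm{Id}_{X}) \circ \cdots \circ (\mathrm{Id}_{X}^{\times (i-1)} \times R \times \mathrm{Id}_{X}^{\times (n-i-1)}).$$ Equivalently: $d^l_{i,n}$ applies $R$ successively to the coordinates in positions $(i-1,i),(i-2,i-1),\ldots,(1,2)$ and then deletes the first coordinate (so $d^l_{1,n}(x_1,\ldots,x_n)=(x_2,\ldots,x_n)$); $d^r_{i,n}$ applies $R$ successively to the coordinates in positions $(i,i+1),(i+1,i+2),\ldots,(n-1,n)$ and then deletes the last coordinate (so $d^r_{n,n}(x_1,\ldots,x_n)=(x_1,\ldots,x_{n-1})$). In particular $\partial_1^{YB}=0$. It is known that $(C_n^{YB}(X),\partial_n^{YB})$ is a chain complex. For $n\ge 2$, $C_n^D(X)$ is the subgroup of $C_n^{YB}(X)$ spanned by the tuples $(x_1,\ldots,x_n)\in X^n$ such that $R(x_i,x_{i+1})=(x_i,x_{i+1})$ for some $i\in\{1,\ldots,n-1\}$; for $n<2$, $C_n^D(X)=0$. *)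

(* Defs.v *)
From mathcomp Require Import all_boot all_order all_algebra.
From mathcomp Require Import boolp.
From mathcomp Require Export freeg.

Set Implicit Arguments.
Unset Strict Implicit.
Unset Printing Implicit Defensive.

Import GRing.Theory.
Local Open Scope ring_scope.

Section YangBaxterOperator.
Variables (X : Type) (R : X * X -> X * X).

(* R x Id and Id x R on X^3 = (X * X) * X *)
Definition R_Id (t : X * X * X) : X * X * X :=
  let: (x, y, z) := t in (R (x, y), z).

Definition Id_R (t : X * X * X) : X * X * X :=
  let: (x, y, z) := t in (x, (R (y, z)).1, (R (y, z)).2).

Definition YB_operator : Prop :=
  bijective R /\ R_Id \o Id_R \o R_Id =1 Id_R \o R_Id \o Id_R.

End YangBaxterOperator.

Section YangBaxterComplex.
Variables (X : Type) (R : X * X -> X * X).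

(* Id^k x R x Id^(n-k-2) on sequences of length n, i.e. R acting on the
   coordinates of 0-based indices k and k+1; it is the identity on sequences
   of length < k+2, a case that does not occur in the face maps. *)
Fixpoint seq_apply_R (k : nat) (s : seq X) : seq X :=
  match k, s with
  | 0, x :: y :: s' => (R (x, y)).1 :: (R (x, y)).2 :: s'
  | k'.+1, x :: s' => x :: seq_apply_R k' s'
  | _, _ => s
  end.

Lemma size_seq_apply_R k s : size (seq_apply_R k s) = size s.
Proof. by elim: k s => [|k IHk] [|x [|y s]] //=; rewrite IHk. Qed.

Lemma apply_R_subproof n k (t : n.-tuple X) : size (seq_apply_R k t) == n.
Proof. by rewrite size_seq_apply_R size_tuple. Qed.

Definition apply_R n (k : nat) (t : n.-tuple X) : n.-tuple X :=
  Tuple (apply_R_subproof k t).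

(* With 0-based i : 'I_n.+1, face_l i and face_r i are d^l_{i+1,n+1} and
   d^r_{i+1,n+1}. The former applies R at indices i-1, ..., 1, 0 in this order
   (foldr processes the list from its end) and drops the first coordinate; the
   latter applies R at indices i, i+1, ..., n-1 in this order and drops the
   last coordinate. *)
Definition face_l n (i : 'I_n.+1) (t : n.+1.-tuple X) : n.-tuple X :=
  [tuple of behead (foldr (@apply_R n.+1) t (iota 0 i))].

Definition drop_last n (t : n.+1.-tuple X) : n.-tuple X :=
  [tuple of belast (thead t) [tuple of behead t]].

Definition face_r n (i : 'I_n.+1) (t : n.+1.-tuple X) : n.-tuple X :=
  drop_last (foldl (fun u k => apply_R k u) t (iota i (n - i))).

(* {classic _} endows the tuples over an arbitrary type with the choice
   structure required by {freeg _ / int}. *)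
Definition chain (n : nat) := {freeg {classic (n.-tuple X)} / int}.

Definition generator n (t : n.-tuple X) : chain n :=
  << (t : {classic (n.-tuple X)}) >>.

(* The sign (-1)^(i+1) of the 1-based index is (-1)^i for the 0-based one. *)
Definition boundary n (c : chain n.+1) : chain n :=
  \sum_(i < n.+1) (-1) ^+ i *:
    (fglift (fun t : {classic (n.+1.-tuple X)} => generator (face_l i t)) c
     - fglift (fun t : {classic (n.+1.-tuple X)} => generator (face_r i t)) c).

Definition degenerate_tuple n (t : n.-tuple X) : Prop :=
  exists i j : 'I_n, j = i.+1 :> nat /\
    R (tnth t i, tnth t j) = (tnth t i, tnth t j).

(* For n < 2 no tuple is degenerate, so that only the zero chain qualifies. *)
Definition degenerate_chain n (c : chain n) : Prop :=
  exists (m : nat) (a : 'I_m -> int) (t : 'I_m -> n.-tuple X),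
    (forall k, degenerate_tuple (t k)) /\
    c = \sum_(k < m) a k *: generator (t k).

End YangBaxterComplex.

(* Main.v *)
From HB Require Import structures.
Require Import Defs.
From mathcomp Require Import all_boot all_order all_algebra.
From mathcomp Require Import boolp zify.

(** Write r_k for R acting on the coordinates k and k+1 of a tuple (positions
    counted from 0).  The Yang-Baxter equation makes these maps satisfy the
    braid relations r_k r_(k+1) r_k = r_(k+1) r_k r_(k+1) and r_i r_k = r_k r_i
    for |i - k| > 1, and a tuple is degenerate exactly when some r_j fixes it.

    The left face number i applies the braid word L_i = r_0 r_1 ... r_(i-1) and
    forgets the first coordinate.  Let r_j t = t.

    - For i = j and i = j+1 the two faces coincide, since
      L_(j+1) t = L_j (r_j t) = L_j t.  They enter the boundary with opposite
      signs, so they cancel.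
    - For i < j, r_j commutes with L_i, so L_i t is still fixed by r_j.
    - For i > j+1, the braid relations give r_(j+1) L_i = L_i r_j
      ([foldr_shift]), so L_i t is fixed by r_(j+1).

    In the last two cases the generator that fixes L_i t does not touch the
    first coordinate, so the face is degenerate.  The right faces are symmetric:
    their word M_i = r_(n-1) ... r_(i+1) r_i, on tuples of length n+1, satisfies
    r_j M_i = M_i r_(j+1) for i <= j < n-1 ([foldl_shift]).

    Hence the boundary of a degenerate generator is a combination of degenerate
    generators ([degenerate_alternating_sum] for either family of faces), and
    the general case follows by linearity. *)

Set Implicit Arguments.
Unset Strict Implicit.
Unset Printing Implicit Defensive.

Import GRing.Theory.

(** * Words in braid generators *)

Lemma foldr_iotaS (T : Type) (r : nat -> T -> T) i s :
  foldr r s (iota 0 i.+1) = foldr r (r i s) (iota 0 i).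
Proof. by rewrite -addn1 iotaD foldr_cat. Qed.

Section BraidWords.
Variables (T : Type) (r : nat -> T -> T) (N : nat).
Hypothesis r_far : forall i j, i.+1 < j -> forall s, r i (r j s) = r j (r i s).
Hypothesis r_braid : forall i, i.+1 < N ->
  forall s, r i (r i.+1 (r i s)) = r i.+1 (r i (r i.+1 s)).

Local Notation lword i s := (foldr r s (iota 0 i)).
Local Notation rword i m s := (foldl (fun u k => r k u) s (iota i m)).

Lemma foldr_far k i s : i < k -> r k (lword i s) = lword i (r k s).
Proof.
elim: i s => [|i IHi] s // lt_ik.
by rewrite !foldr_iotaS IHi 1?ltnW // -r_far.
Qed.

Lemma foldl_far k i m s : k.+1 < i -> r k (rword i m s) = rword i m (r k s).
Proof.
elim: m i s => [|m IHm] i s //= lt_ki.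
by rewrite IHm 1?ltnW // r_far.
Qed.

(** The generator r_(j+1) commutes with r_0, ..., r_(j-1); then the relation
    r_(j+1) (r_j r_(j+1)) = (r_j r_(j+1)) r_j turns it into r_j, which commutes
    with the remaining letters r_(j+2), ..., r_(i-1). *)
Lemma foldr_shift j i s : j.+1 < i -> i <= N ->
  r j.+1 (lword i s) = lword i (r j s).
Proof.
elim: i s => [|i IHi] s // lt_ji le_iN.
rewrite !foldr_iotaS.
have [->|ne_ij] := eqVneq i j.+1; last first.
  by rewrite IHi 1?(@r_far j i) //; lia.
by rewrite !foldr_iotaS foldr_far // -r_braid //; lia.
Qed.

(** The mirror image of [foldr_shift], for the word r_(i+m-1) ... r_(i+1) r_i:
    here the two adjacent letters satisfy
    r_j (r_(j+1) r_j) = (r_(j+1) r_j) r_(j+1). *)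
Lemma foldl_shift i m j s : i <= j -> j.+1 < i + m -> i + m <= N ->
  r j (rword i m s) = rword i m (r j.+1 s).
Proof.
elim: m i s => [|m IHm] i s le_ij lt_jim le_imN; first by lia.
rewrite /=; have [->|ne_ij] := eqVneq j i; last first.
  by rewrite IHm -1?(@r_far i j.+1) //; lia.
case: m {IHm} lt_jim le_imN => [|m] lt_jim le_imN /=; first by lia.
by rewrite foldl_far // r_braid //; lia.
Qed.

End BraidWords.

(** * Braid relations for the action of R on tuples *)

Section TupleBraid.
Variables (X : Type) (R : X * X -> X * X).

Lemma seq_apply_R_far i j s : i.+1 < j ->
  seq_apply_R R i (seq_apply_R R j s) = seq_apply_R R j (seq_apply_R R i s).
Proof.
elim: i j s => [|i IHi] [|j] [|x s] //=.
  by case: j s => [|j] [|y s].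
by move=> lt_ij; rewrite IHi.
Qed.

(** The bound on [i] matters: on a sequence of length [i.+2] the map of index
    [i.+1] is the identity, and the relation would say that R is idempotent. *)
Lemma seq_apply_R_braid (hR : YB_operator R) i s : i.+2 < size s ->
  seq_apply_R R i (seq_apply_R R i.+1 (seq_apply_R R i s))
    = seq_apply_R R i.+1 (seq_apply_R R i (seq_apply_R R i.+1 s)).
Proof.
elim: i s => [|i IHi] [|x s] //= lt_is; last by rewrite IHi.
case: s lt_is => [|y [|z s]] //= _.
have [_ /(_ (x, y, z))] := hR; rewrite /R_Id /Id_R /=.
case: (R (x, y)) => a b /=; case: (R (y, z)) => c d /=.
case: (R (b, z)) => e f /=; case: (R (x, c)) => g h /=.
case: (R (a, e)) => k l /=; case: (R (h, d)) => m p /=.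
by case=> -> -> ->.
Qed.

Lemma apply_R_far n i j : i.+1 < j ->
  forall t : n.-tuple X,
    apply_R R i (apply_R R j t) = apply_R R j (apply_R R i t).
Proof. by move=> lt_ij t; apply: val_inj; rewrite /= seq_apply_R_far. Qed.

Lemma apply_R_braid (hR : YB_operator R) n i : i.+1 < n ->
  forall t : n.+1.-tuple X,
    apply_R R i (apply_R R i.+1 (apply_R R i t))
      = apply_R R i.+1 (apply_R R i (apply_R R i.+1 t)).
Proof.
by move=> lt_in t; apply: val_inj; rewrite /= seq_apply_R_braid ?size_tuple.
Qed.

(** * Degenerate tuples as fixed points *)

Lemma seq_apply_R_fixedP x0 k s : k.+1 < size s ->
  seq_apply_R R k s = s <->
  R (nth x0 s k, nth x0 s k.+1) = (nth x0 s k, nth x0 s k.+1).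
Proof.
elim: k s => [|k IHk] [|x s] //=.
  case: s => [|y s] //= _; split=> [|-> //].
  by case: (R (x, y)) => a b [-> ->].
by rewrite ltnS => /IHk <-; split=> [[]|->].
Qed.

(** This turns degeneracy into an equation between tuples, on which the braid
    relations can act. *)
Lemma degenerate_tupleP n (t : n.-tuple X) :
  degenerate_tuple R t <-> exists2 k, k.+1 < n & apply_R R k t = t.
Proof.
split=> [[i [j [ji Rij]]]|[k lt_kn /(congr1 val) /= Rt]].
  have lt_in : i.+1 < n by rewrite -ji.
  exists i => //; apply: val_inj => /=.
  apply/(seq_apply_R_fixedP (tnth t i)); first by rewrite size_tuple.
  by rewrite -ji -!tnth_nth.
have lt_kn' := ltnW lt_kn.
exists (Ordinal lt_kn'), (Ordinal lt_kn); split=> //.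
have x0 := tnth t (Ordinal lt_kn'); rewrite !(tnth_nth x0) /=.
by apply/(seq_apply_R_fixedP x0) => //; rewrite size_tuple.
Qed.

Lemma degenerate_behead n (t : n.+1.-tuple X) k :
  k.+1 < n -> apply_R R k.+1 t = t -> degenerate_tuple R [tuple of behead t].
Proof.
move=> lt_kn /(congr1 val) /= Rt.
apply/degenerate_tupleP; exists k => //; apply: val_inj => /=.
by rewrite -{2}Rt; case: (tval t) => // {lt_kn Rt}; case: k.
Qed.

Lemma degenerate_drop_last n (t : n.+1.-tuple X) k :
  k.+1 < n -> apply_R R k t = t -> degenerate_tuple R (drop_last t).
Proof.
case/tupleP: t => x t lt_kn /(congr1 val) Rt.
have lt_k : k.+1 < size (x :: t) by rewrite /= size_tuple ltnS ltnW.
have [/(_ Rt) fixed_k _] := seq_apply_R_fixedP x lt_k.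
rewrite lastI !nth_rcons size_belast size_tuple lt_kn (ltnW lt_kn) in fixed_k.
apply/degenerate_tupleP; exists k => //; apply: val_inj; rewrite /= theadE.
by apply/(seq_apply_R_fixedP x) => //; rewrite size_belast size_tuple.
Qed.

(** * Faces of a degenerate tuple *)

Lemma face_l_eq n j (t : n.+1.-tuple X) (i i1 : 'I_n.+1) :
    apply_R R j t = t -> i = j :> nat -> i1 = j.+1 :> nat ->
  face_l R i1 t = face_l R i t.
Proof.
by move=> Rt iE i1E; apply: val_inj; rewrite /= iE i1E foldr_iotaS Rt.
Qed.

Lemma face_r_eq n j (t : n.+1.-tuple X) (i i1 : 'I_n.+1) :
    apply_R R j t = t -> i = j :> nat -> i1 = j.+1 :> nat ->
  face_r R i1 t = face_r R i t.
Proof.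
move=> Rt iE i1E; have lt_jn : j < n by rewrite -ltnS -i1E.
by rewrite /face_r iE i1E -(subnSK lt_jn) /= Rt.
Qed.

Lemma degenerate_face_l (hR : YB_operator R) n j (t : n.+1.-tuple X)
    (i : 'I_n.+1) :
    j < n -> apply_R R j t = t -> i != j :> nat -> i != j.+1 :> nat ->
  degenerate_tuple R (face_l R i t).
Proof.
move=> lt_jn Rt ne_ij ne_ij1; have := ltn_ord i; rewrite ltnS => le_in.
have [lt_ij|le_ji] := ltnP i j.
  apply: (@degenerate_behead _ _ j.-1); first by lia.
  by rewrite (ltn_predK lt_ij) (foldr_far (@apply_R_far _)) // Rt.
apply: (@degenerate_behead _ _ j); first by lia.
by rewrite (foldr_shift (@apply_R_far _) (@apply_R_braid hR _)) ?Rt //; lia.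
Qed.

Lemma degenerate_face_r (hR : YB_operator R) n j (t : n.+1.-tuple X)
    (i : 'I_n.+1) :
    j < n -> apply_R R j t = t -> i != j :> nat -> i != j.+1 :> nat ->
  degenerate_tuple R (face_r R i t).
Proof.
move=> lt_jn Rt ne_ij ne_ij1; have := ltn_ord i; rewrite ltnS => le_in.
have [lt_ij|le_ji] := ltnP i j.
  apply: (@degenerate_drop_last _ _ j.-1); first by lia.
  rewrite (foldl_shift (@apply_R_far _) (@apply_R_braid hR _)); try lia.
  by rewrite (ltn_predK lt_ij) Rt.
apply: (@degenerate_drop_last _ _ j); first by lia.
by rewrite (foldl_far (@apply_R_far _)) ?Rt //; lia.
Qed.

End TupleBraid.

(** * Degenerate chains *)

Local Open Scope ring_scope.

HB.instance Definition _ (K : choiceType) (M : lmodType int) (f : K -> M) :=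
  GRing.isZmodMorphism.Build _ _ (fglift f) (lift_is_additive f).

Lemma fgliftZ (K : choiceType) (M : lmodType int) (f : K -> M) (a : int)
    (c : {freeg K / int}) :
  fglift f (a *: c) = a *: fglift f c.
Proof. by rewrite -[a]intz !scaler_int raddfMz. Qed.

Section DegenerateChains.
Variables (X : Type) (R : X * X -> X * X).

Lemma degenerate_chain0 n : degenerate_chain R (0 : chain X n).
Proof.
exists 0, (fun=> 0), (fun i : 'I_0 => False_rect _ (notF (ltn_ord i))).
by split=> [[]|] //; rewrite big_ord0.
Qed.

Lemma degenerate_chainD n (c1 c2 : chain X n) :
  degenerate_chain R c1 -> degenerate_chain R c2 ->
  degenerate_chain R (c1 + c2).
Proof.
move=> [m1 [a1 [t1 [deg1 ->]]]] [m2 [a2 [t2 [deg2 ->]]]].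
exists (m1 + m2)%N.
exists (fun k => match split k with inl i => a1 i | inr i => a2 i end).
exists (fun k => match split k with inl i => t1 i | inr i => t2 i end).
split=> [k|]; first by case: split.
rewrite big_split_ord /=; congr (_ + _); apply: eq_bigr => i _.
  by rewrite (unsplitK (inl _ i)).
by rewrite (unsplitK (inr _ i)).
Qed.

Lemma degenerate_chainZ n (a : int) (c : chain X n) :
  degenerate_chain R c -> degenerate_chain R (a *: c).
Proof.
move=> [m [b [t [degt ->]]]]; exists m, (fun k => a * b k), t; split=> //.
by rewrite scaler_sumr; apply: eq_bigr => k _; rewrite scalerA.
Qed.

Lemma degenerate_chainB n (c1 c2 : chain X n) :
  degenerate_chain R c1 -> degenerate_chain R c2 ->
  degenerate_chain R (c1 - c2).
Proof.
move=> deg1 deg2; rewrite -scaleN1r.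
exact/degenerate_chainD/degenerate_chainZ.
Qed.

Lemma degenerate_chain_sum n (I : Type) (r : seq I) (P : pred I)
    (F : I -> chain X n) :
  (forall i, P i -> degenerate_chain R (F i)) ->
  degenerate_chain R (\sum_(i <- r | P i) F i).
Proof.
move=> degF; apply: (big_ind (@degenerate_chain X R n)) => //.
  exact: degenerate_chain0.
exact: degenerate_chainD.
Qed.

Lemma degenerate_generator n (t : n.-tuple X) :
  degenerate_tuple R t -> degenerate_chain R (generator t).
Proof.
move=> degt; exists 1%N, (fun=> 1), (fun=> t); split=> //.
by rewrite big_ord1 scale1r.
Qed.

(** The two possibly nondegenerate terms are equal and adjacent, so they carry
    opposite signs and cancel. *)
Lemma degenerate_alternating_sum n m (f : 'I_n -> m.-tuple X) (j j1 : 'I_n) :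
    j1 = j.+1 :> nat -> f j1 = f j ->
    (forall i, i != j -> i != j1 -> degenerate_tuple R (f i)) ->
  degenerate_chain R (\sum_(i < n) (-1) ^+ i *: generator (f i)).
Proof.
move=> j1E f_j1 degf.
have ne_j1j : j1 != j by rewrite -val_eqE /= j1E neq_ltn ltnSn orbT.
rewrite (bigD1 j) // (bigD1 j1) //= addrA f_j1 j1E exprS mulN1r scaleNr.
rewrite subrr add0r; apply: degenerate_chain_sum => i /andP[ne_ij ne_ij1].
exact/degenerate_chainZ/degenerate_generator/degf.
Qed.

(** The left and right faces are kept in separate sums because cancellation
    takes place within each family. *)
Lemma boundary_sum n m (a : 'I_m -> int) (t : 'I_m -> n.+1.-tuple X) :
  boundary R (\sum_(k < m) a k *: generator (t k)) =
  \sum_(k < m) a k *: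
    (\sum_(i < n.+1) (-1) ^+ i *: generator (face_l R i (t k))
     - \sum_(i < n.+1) (-1) ^+ i *: generator (face_r R i (t k))).
Proof.
rewrite /boundary.
under eq_bigr => i _.
  rewrite !raddf_sum -big_split scaler_sumr /=.
  under eq_bigr => k _ do
    rewrite !fgliftZ !liftU !scale1r -scalerBr scalerA mulrC -scalerA.
  over.
rewrite exchange_big /=; apply: eq_bigr => k _.
rewrite -scaler_sumr -sumrB; congr (_ *: _).
by apply: eq_bigr => i _; rewrite scalerBr.
Qed.

End DegenerateChains.

Local Close Scope ring_scope.

Theorem proposition2p1 (X : Type) (R : X * X -> X * X) (hR : YB_operator R)
    (n : nat) (c : chain X n.+1) (hc : degenerate_chain R c) :
  degenerate_chain R (boundary R c).
Proof.
have [m [a [t [degt ->]]]] := hc; rewrite boundary_sum.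
apply: degenerate_chain_sum => k _; apply: degenerate_chainZ.
have /degenerate_tupleP[j lt_jn Rt] := degt k; rewrite ltnS in lt_jn.
pose j0 : 'I_n.+1 := Ordinal (ltnW (lt_jn : j.+1 < n.+1)).
pose j1 : 'I_n.+1 := Ordinal (lt_jn : j.+1 < n.+1).
apply: degenerate_chainB.
- apply: (degenerate_alternating_sum (j := j0) (j1 := j1)) => //.
    exact: face_l_eq Rt _ _.
  by move=> i; apply: degenerate_face_l.
- apply: (degenerate_alternating_sum (j := j0) (j1 := j1)) => //.
    exact: face_r_eq Rt _ _.
  by move=> i; apply: degenerate_face_r.
Qed.
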